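(* Let $q_f\approx 1.75488$ be the real root of $x^3=2x^2-x+1$. In base $q=q_f$ all of the following situations occur: for each $k=1,2,3,\ldots$, and for $k=\aleph_0$ and $k=2^{\aleph_0}$, there exists $x\in I_{q}$ having exactly $k$ $q$-expansions. Moreover, $q_f$ is the smallest $q\in(1,2)$ satisfying this property.
   Context: For $q\in(1,2)$ let $I_q=[0,\frac{1}{q-1}]$. For $x\in I_q$, a $q$-expansion of $x$ is a sequence $(\epsilon_i)_{i=1}^\infty\in\{0,1\}^{\mathbb{N}}$ with $x=\sum_{i=1}^\infty \epsilon_i q^{-i}$. ''Exactly $k$ $q$-expansions'' means that the set of all $q$-expansions of $x$ has cardinality $k$. *)

(* Defs.v *)
From HB Require Import structures.
From mathcomp Require Import all_boot all_order all_algebra.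
From mathcomp Require Import all_classical all_reals all_analysis.

Set Implicit Arguments.
Unset Strict Implicit.
Unset Printing Implicit Defensive.

Import Order.TTheory GRing.Theory Num.Theory.
Import numFieldNormedType.Exports.

Local Open Scope classical_set_scope.
Local Open Scope card_scope.
Local Open Scope ring_scope.

Definition Iq (R : realType) (q : R) : set R := `[0, (q - 1)^-1]%classic.

(* The digit sequence is indexed from 0: [eps i] is the coefficient of
   [q ^- i.+1], and a boolean digit is read as 0 or 1. *)
Definition expansions (R : realType) (q x : R) : set (nat -> bool) :=
  [set eps : nat -> bool |
    (series (fun i : nat => (eps i)%:R * q ^- i.+1) : nat -> R) @ \oo --> x].

(* [nat -> bool] serves as the reference set of cardinality 2^aleph_0. *)
Definition all_multiplicities (R : realType) (q : R) : Prop :=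
  [/\ forall k : nat, (0 < k)%N ->
        exists2 x : R, Iq q x & expansions q x #= `I_k,
      exists2 x : R, Iq q x & expansions q x #= [set: nat]
    & exists2 x : R, Iq q x & expansions q x #= [set: nat -> bool]].

(* Main.v *)
Require Import Defs.
From HB Require Import structures.
From mathcomp Require Import all_boot all_order all_algebra.
From mathcomp Require Import all_classical all_reals all_analysis.
From mathcomp Require Import ring lra.

(** Write [M = 1 / (q - 1)].  An expansion of [x] that starts with the digit 0
    continues with an expansion of [q * x], one that starts with 1 continues
    with an expansion of [q * x - 1], and a number has expansions if and only
    if it lies in [[0, M]].  Hence the multiplicity of [x] is the sum of those
    of [q * x] and [q * x - 1], and both terms are positive exactly on the switch
    region [1 <= q * x <= M].  The threshold [qf] is the solution of
    [q * (q - 1) ^ 2 = 1], which is the same cubic equation.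

    Below the threshold, no number has two expansions or no number has three.
    When [q * (q - 1) ^ 2 <= 1], a unique expansion contains neither 011 nor 100,
    so it is constant or ends in 101010... after a constant prefix: with
    [c = q / (q ^ 2 - 1)] the univoque numbers are among [0], [M], [c / q ^ n]
    and [M - c / q ^ n] ([unique_lt1], [unique_ge1]).  A number with two expansions
    yields univoque numbers [y] and [y + 1], hence an equation between powers of
    [q]; when [q * (q - 1) ^ 2 < 1] it is solvable only if
    [q ^ 4 = 2 * q ^ 2 + q + 1], about 1.7106, and [y] is then [c / q ^ 2] or
    [c / q ^ 4] ([two_powers], [unique_pair]).  A number with three expansions
    yields, up to reflection, a univoque [u] such that [u - 1] has two
    expansions; in the quartic base the known list of the [u] and of the [y]
    refutes this ([quartic_three_impossible]).

    At the threshold, the number [1 / q] returns to itself after the digits 0110,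
    and on the way it meets both end points of the switch region.  The exits
    there lead to 0 and [M], so [1 / q] has infinitely many expansions, all of
    them known ([threshold_countable]).  Numbers slightly larger than [1 / q]
    keep only the first exit, and going round the loop adds exactly one
    expansion if the exit leads to a univoque number: this produces all finite
    multiplicities ([threshold_finite]).  Finally [q ^ 4 = q ^ 3 + q ^ 2 + 1], so
    the blocks 10000 and 01101 are interchangeable, and the number
    with the periodic expansion 10000 10000 ... has a continuum of expansions
    ([threshold_continuum]). *)

Set Implicit Arguments.
Unset Strict Implicit.
Unset Printing Implicit Defensive.

Import Order.TTheory GRing.Theory Num.Theory.
Import numFieldNormedType.Exports.

Local Open Scope classical_set_scope.
Local Open Scope card_scope.
Local Open Scope ring_scope.

(** * Digit sequences and finite cardinals *)

Definition cons_seq (b : bool) (e : nat -> bool) : nat -> bool :=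
  fun n => if n is m.+1 then e m else b.

Lemma cons_seqK (e : nat -> bool) : cons_seq (e 0%N) (e \o succn) = e.
Proof. by apply/funext => -[]. Qed.

Lemma cons_seq_inj b : injective (cons_seq b).
Proof. by move=> e f ef; apply/funext => n; have := congr1 (@^~ n.+1) ef. Qed.

Lemma card_disjointU (T : choiceType) (A B : set T) (a b : nat) :
  A `&` B = set0 -> A #= `I_a -> B #= `I_b -> A `|` B #= `I_(a + b).
Proof.
move=> AB Aa Bb.
have fA : finite_set A by exists a.
have fB : finite_set B by exists b.
rewrite -(fset_setK (A := A `|` B)) ?finite_setU //; apply/card_eq_fsetP.
rewrite fset_setU // -(card_fset_set Aa) -(card_fset_set Bb).
apply/eqP; have [_ ->] := finmap.leq_card_fsetU (fset_set A) (fset_set B).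
by rewrite -finmap.fsetI_eq0 -fset_setI // AB fset_set0.
Qed.

Lemma card_pos (T : Type) (A : set T) (k : nat) :
  A #= `I_k -> A !=set0 -> (0 < k)%N.
Proof.
by case: k => // A0 An0; move: A0; rewrite II0 card_eq0 => /eqP A0; move: An0;
  rewrite A0 => -[].
Qed.

Lemma add_pos_eq2 (a b : nat) :
  (0 < a)%N -> (0 < b)%N -> (a + b)%N = 2%N -> a = 1%N /\ b = 1%N.
Proof. by case: a b => [|[|[|a]]] [|[|b]]. Qed.

Lemma add_pos_eq3 (a b : nat) :
  (0 < a)%N -> (0 < b)%N -> (a + b)%N = 3%N ->
  (a = 1%N /\ b = 2%N) \/ (a = 2%N /\ b = 1%N).
Proof. by case: a b => [|[|[|[|a]]]] [|[|[|b]]] //; [left|right]. Qed.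

(** * The digit tree of a number *)

Section Expansions.
Variables (R : realType) (q : R).
Hypotheses (q_gt1 : 1 < q) (q_lt2 : q < 2).
Local Notation E := (expansions q).
Local Notation M := ((q - 1)^-1).
Local Notation digits e := (fun i : nat => (e i)%:R * q ^- i.+1).

Let q_gt0 : 0 < q. Proof. by move: q_gt1; lra. Qed.
Let q_neq0 : q != 0. Proof. by rewrite gt_eqF. Qed.
Let q1_gt0 : 0 < q - 1. Proof. by move: q_gt1; lra. Qed.
Let M_gt0 : 0 < M. Proof. by rewrite invr_gt0. Qed.

Let M_gt1 : 1 < M. Proof. by rewrite invf_gt1 //; move: q_lt2; lra. Qed.

Lemma fixed_right_end : q * M = 1 + M.
Proof. by field; rewrite gt_eqF. Qed.

(** Digit sequences are controlled by the orbit of remainders that they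
    produce: the partial sums of [e] are [r 0 - r n * q ^- n], so a bounded
    orbit forces convergence. *)
Lemma expansion_of_orbit (r : nat -> R) (e : nat -> bool) (K : R) :
  (forall n, `|r n| <= K) -> (forall n, r n.+1 = q * r n - (e n)%:R) ->
  E (r 0%N) e.
Proof.
move=> rK rS.
have sE n : series (digits e) n = r 0%N - r n * q ^- n.
  elim: n => [|n IH]; first by rewrite /series /= big_geq // expr0 invr1 mulr1
    subrr.
  rewrite seriesSr IH rS exprS.
  by field; rewrite q_neq0 expf_neq0.
rewrite /expansions /= (_ : series _ = fun n => r 0%N - r n * q ^- n);
  last first.
  exact/funext.
rewrite -[X in _ --> X]subr0; apply: cvgB; first exact: cvg_cst.
apply/norm_cvg0P; apply: (@squeeze_cvgr _ _ _ _ (fun=> 0) (fun n => K * q^-1 ^+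
  n)).
- near=> n; rewrite normr_ge0 normrM /= exprVn ler_pM //.
  by rewrite ger0_norm // invr_ge0 exprn_ge0 // ltW.
- exact: cvg_cst.
- rewrite -[X in _ --> X](mulr0 K); apply: cvgM; first exact: cvg_cst.
  by apply: cvg_expr; rewrite ger0_norm ?invr_ge0 ?ltW // invf_lt1.
Unshelve. all: by end_near. Qed.

Lemma expansions_step x e :
  E x e <-> E (q * x - (e 0%N)%:R) (e \o succn).
Proof.
have sE n : series (digits (e \o succn)) n =
    q * series (digits e) n.+1 - (e 0%N)%:R.
  rewrite /series /= big_nat_recl // expr1 mulrDr mulrCA divff // mulr1.
  rewrite [RHS]addrAC subrr add0r mulr_sumr; apply: eq_bigr => i _ /=.
  by rewrite (exprS q i.+1); field; rewrite q_neq0 expf_neq0.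
have E1 : E x e <-> (series (digits e) n.+1 @[n --> \oo] --> x).
  by rewrite /expansions /= -(cvg_shiftS (series (digits e))).
rewrite E1 /expansions /= (funext sE); split=> xe.
- by apply: cvgB; [apply: cvgM => //; exact: cvg_cst|exact: cvg_cst].
- have eK y : y = q^-1 * (q * y - (e 0%N)%:R + (e 0%N)%:R) by rewrite subrK
  mulKf.
  rewrite (eK x) (funext (fun n => eK (series (digits e) n.+1))).
  apply: cvgM; first exact: cvg_cst.
  by apply: cvgD => //; exact: cvg_cst.
Qed.

Lemma expansions_cons b x e :
  E x (cons_seq b e) <-> E (q * x - b%:R) e.
Proof. exact: expansions_step. Qed.

Lemma expansions_range x e : E x e -> 0 <= x <= M.
Proof.
have S0 n : 0 <= series (digits e) n <= M * (1 - q ^- n).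
  elim: n => [|n /andP[S0 SM]].
    by rewrite /series /= big_geq // expr0 invr1 subrr mulr0 lexx.
  have qn : 0 < q ^- n.+1 by rewrite invr_gt0 exprn_gt0.
  rewrite seriesSr; apply/andP; split.
    by rewrite addr_ge0 // mulr_ge0 // ltW.
  have eM : M * (1 - q ^- n.+1) = M * (1 - q ^- n) + q ^- n.+1.
    by rewrite exprS; field; rewrite q_neq0 expf_neq0 // gt_eqF.
  rewrite eM lerD //; case: (e n); rewrite ?mul1r // mul0r; exact: ltW.
move=> xe; have cx : cvgn (series (digits e)) by apply/cvg_ex; exists x.
rewrite -(cvg_lim _ xe) //; apply/andP; split.
- by apply: limr_ge => //; near=> n; have /andP[] := S0 n.
- apply: limr_le => //; near=> n; have /andP[_ /le_trans ->] // := S0 n.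
  rewrite ler_piMr ?(ltW M_gt0) // gerBl invr_ge0 exprn_ge0 //; exact: ltW.
Unshelve. all: by end_near. Qed.

(** The greedy expansion; it needs [1 <= M], that is [q <= 2], for the
    remainder to stay in range when the digit 0 is chosen. *)
Lemma expansions_nonempty x : 0 <= x <= M -> E x !=set0.
Proof.
move=> x0M.
pose f (y : R) : R := q * y - ((1 <= q * y)%R)%:R.
pose r n := iter n f x.
have r0M n : 0 <= r n <= M.
  elim: n => [//|n /andP[r0 rM]]; rewrite /r iterS -/(r n) /f.
  have := fixed_right_end; have : q * r n <= q * M by rewrite ler_pM2l.
  have := M_gt1.
  have : 0 <= q * r n by rewrite mulr_ge0 // ltW.
  by case: (lerP 1 (q * r n)) => ? /=; lra.
exists (fun n => (1 <= q * r n)%R); apply: (@expansion_of_orbit r _ M) => // n.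
by have /andP[? ?] := r0M n; rewrite ger0_norm.
Qed.

Lemma expansions_split x :
  E x = cons_seq false @` E (q * x) `|` cons_seq true @` E (q * x - 1).
Proof.
apply/seteqP; split=> [e|e [|] [f xf <-]]; last 2 first.
- by apply/expansions_cons; rewrite subr0.
- exact/expansions_cons.
rewrite -[e]cons_seqK => /expansions_cons; case: (e 0%N) => xe; [right|left].
  by exists (e \o succn).
by exists (e \o succn) => //; move: xe; rewrite subr0.
Qed.

Lemma expansions_empty x : ~~ (0 <= x <= M) -> E x = set0.
Proof. by move=> xM; apply/seteqP; split=> // e /expansions_range;
  apply/negP. Qed.

Lemma expansions_low x : q * x < 1 -> E x = cons_seq false @` E (q * x).
Proof.
move=> x1; rewrite expansions_split (expansions_empty (x := q * x - 1))
  ?image_set0 ?setU0 //.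
by rewrite negb_and -ltNge subr_lt0 x1.
Qed.

Lemma expansions_high x : M < q * x -> E x = cons_seq true @` E (q * x - 1).
Proof.
move=> x1; rewrite expansions_split (expansions_empty (x := q * x)) ?image_set0
  ?set0U //.
by rewrite negb_and -!ltNge x1 orbT.
Qed.

Lemma card_expansions_low x : q * x < 1 -> E x #= E (q * x).
Proof. by move=> /expansions_low ->;
  apply: inj_card_eq => e f _ _ /cons_seq_inj. Qed.

Lemma card_expansions_high x : M < q * x -> E x #= E (q * x - 1).
Proof. by move=> /expansions_high ->;
  apply: inj_card_eq => e f _ _ /cons_seq_inj. Qed.

(** Multiplicities are additive along the branching of the digit tree. *)
Lemma card_expansions_add x (a b : nat) :
  E (q * x) #= `I_a -> E (q * x - 1) #= `I_b -> E x #= `I_(a + b).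
Proof.
move=> xa xb; rewrite expansions_split; apply: card_disjointU.
- by apply/seteqP; split=> // _ [[e _ <-] [f _ /(congr1 (@^~ 0%N))]].
- apply: card_eq_trans xa; apply: inj_card_eq => e f _ _; exact: cons_seq_inj.
- apply: card_eq_trans xb; apply: inj_card_eq => e f _ _; exact: cons_seq_inj.
Qed.

(** On the switch region [1 <= q * x <= M] both digits can be continued, so a
    finite multiplicity splits there into two positive parts. *)
Lemma card_expansions_switch x (k : nat) :
  1 <= q * x <= M -> E x #= `I_k ->
  exists a b : nat, [/\ (0 < a)%N, (0 < b)%N, (a + b)%N = k,
     E (q * x) #= `I_a & E (q * x - 1) #= `I_b].
Proof.
move=> /andP[x1 xM] xk.
have : finite_set (E x) by exists k.
rewrite expansions_split finite_setU => -[fa fb].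
have cE b (A : set (nat -> bool)) : cons_seq b @` A #= A.
  by apply: inj_card_eq => e f _ _; exact: cons_seq_inj.
rewrite (eq_finite_set (cE false _)) in fa;
  rewrite (eq_finite_set (cE true _)) in fb.
have [[a xa] [b xb]] := (fa, fb).
exists a, b; split=> //.
- by apply: (card_pos xa); apply: expansions_nonempty;
  rewrite xM andbT (le_trans _ x1).
- apply: (card_pos xb); apply: expansions_nonempty; rewrite subr_ge0 x1 /=.
  by rewrite (le_trans _ xM) // lerBlDr lerDl.
- have xab := card_expansions_add xa xb.
  by apply/card_eq_II; apply: card_eq_trans xk; rewrite card_eq_sym.
Qed.

Lemma switch_two z : 1 <= q * z <= M -> E z #= `I_2 ->
  E (q * z) #= `I_1 /\ E (q * z - 1) #= `I_1.
Proof.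
move=> zs /(card_expansions_switch zs)[a [b [a0 b0 ab za zb]]].
by have [a1 b1] := add_pos_eq2 a0 b0 ab; subst a b.
Qed.

Lemma switch_three z : 1 <= q * z <= M -> E z #= `I_3 ->
  (E (q * z) #= `I_1 /\ E (q * z - 1) #= `I_2) \/
  (E (q * z) #= `I_2 /\ E (q * z - 1) #= `I_1).
Proof.
move=> zs /(card_expansions_switch zs)[a [b [a0 b0 ab za zb]]].
by have [[a1 b1]|[a1 b1]] := add_pos_eq3 a0 b0 ab; subst a b; [left|right].
Qed.

Lemma digit_cases x :
  [\/ q * x < 1, M < q * x | 1 <= q * x <= M].
Proof.
case: (ltP (q * x) 1) => [|x1]; first by constructor 1.
by case: (ltP M (q * x)) => [|xM]; [constructor 2|constructor 3].
Qed.

(** Outside the switch region the first digit is forced and the multiplicity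
    is inherited by the remainder, so the first place where two expansions
    of [x] differ gives a point of the switch region with the same
    multiplicity. *)
Lemma exists_switch x (k : nat) : E x #= `I_k -> (1 < k)%N ->
  exists2 z, 1 <= q * z <= M & E z #= `I_k.
Proof.
move=> xk k1.
have [e [f [n [xe xf efn]]]] : exists e f n, [/\ E x e, E x f & e n != f n].
  case: k k1 xk => [|[|k]] // _ /eq_cardSP[e xe /eq_cardSP[f [xf /= fe] _]].
  have /existsNP[n efn] : ~ (forall n, e n = f n).
    by move=> ef; apply: fe; apply/funext => n; rewrite ef.
  by exists e, f, n; split=> //; apply/eqP.
elim: n x e f xk xe xf efn => [|n IH] x e f xk.
  case: (digit_cases x) => [xl|xh|]; last by exists x.
  - by rewrite expansions_low // => -[e' _ <-] [f' _ <-].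
  - by rewrite expansions_high // => -[e' _ <-] [f' _ <-].
case: (digit_cases x) => [xl|xh|]; last by exists x.
- rewrite expansions_low // => -[e' xe <-] [f' xf <-] /=; apply: IH xe xf.
  by apply: card_eq_trans xk; rewrite card_eq_sym card_expansions_low.
- rewrite expansions_high // => -[e' xe <-] [f' xf <-] /=; apply: IH xe xf.
  by apply: card_eq_trans xk; rewrite card_eq_sym card_expansions_high.
Qed.

Lemma unique_step x : E x #= `I_1 ->
  (q * x < 1 /\ E (q * x) #= `I_1) \/ (M < q * x /\ E (q * x - 1) #= `I_1).
Proof.
move=> x1; case: (digit_cases x) => [xl|xh|xs].
- left; split=> //; apply: card_eq_trans x1;
  by rewrite card_eq_sym card_expansions_low.
- right; split=> //; apply: card_eq_trans x1;
  by rewrite card_eq_sym card_expansions_high.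
- have [a [b [a0 b0 ab _ _]]] := card_expansions_switch xs x1.
  by case: a a0 ab => // a _; case: b b0 => // b _; rewrite addnS.
Qed.

Lemma card_expansions_range x (k : nat) : E x #= `I_k -> (0 < k)%N -> 0 <= x <=
  M.
Proof.
by case: k => // k /eq_cardSP[e /expansions_range].
Qed.

Lemma expansions_orbit x e : E x e ->
  exists r : nat -> R, r 0%N = x /\
    forall n, 0 <= r n <= M /\ r n.+1 = q * r n - (e n)%:R.
Proof.
move=> xe; exists (fix r n := if n is m.+1 then q * r m - (e m)%:R else x).
split=> // n; split=> //; apply: (@expansions_range _ (fun i => e (n + i)%N)).
elim: n => [|n IH]; first by [].
move/expansions_step: IH; rewrite addn0 => IH.
by rewrite (_ : (fun i => _) = (fun i => e (n + i)%N) \o succn) //;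
  apply/funext => i /=; rewrite addnS.
Qed.

(** Complementing all digits; it halves the case analyses below. *)
Lemma card_expansions_reflect x : E (M - x) #= E x.
Proof.
have sub y e : E y e -> E (M - y) (fun n => ~~ e n).
  move=> /expansions_orbit[r [<- rS]].
  apply: (@expansion_of_orbit (fun n => M - r n) _ M) => n.
    by have [/andP[? ?] _] := rS n; rewrite ger0_norm ?subr_ge0 // gerBl.
  have [_ ->] := rS n; have := fixed_right_end.
  by case: (e n) => /=; lra.
rewrite (_ : E (M - x) = (fun e n => ~~ e n) @` E x).
  by apply: inj_card_eq => e f _ _ ef; apply/funext => n; apply: negb_inj;
    rewrite (congr1 (@^~ n) ef).
apply/seteqP; split=> [e /sub|_ [e xe <-]]; last exact: sub.
rewrite subKr => xe; exists (fun n => ~~ e n) => //.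
by apply/funext => n; rewrite negbK.
Qed.

Lemma expansions0 : E 0 = [set fun=> false].
Proof.
have sub n e : E 0 e -> e n = false.
  elim: n e => [|n IH] e; rewrite expansions_low ?mulr0 // => -[f f0 <-] //=.
  exact: IH.
apply/seteqP; split=> [e xe|_ ->]; first by apply/funext => n; exact: sub.
by apply: (@expansion_of_orbit (fun=> 0) _ 0) => n;
  rewrite ?normr0 // mulr0 subr0.
Qed.

Lemma expansionsM : E M = [set fun=> true].
Proof.
have sub n e : E M e -> e n = true.
  elim: n e => [|n IH] e;
    rewrite expansions_high ?fixed_right_end ?ltrDr // addrAC subrr add0r =>
      -[f fM <-] //=.
  exact: IH.
apply/seteqP; split=> [e xe|_ ->]; first by apply/funext => n; exact: sub.
by apply: (@expansion_of_orbit (fun=> M) _ M) => n;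
  rewrite ?ger0_norm ?(ltW M_gt0) // fixed_right_end addrAC subrr add0r.
Qed.

End Expansions.

(** * Univoque numbers up to the threshold *)

Lemma expr_unbounded (R : realType) (q K : R) : 1 < q -> exists n, K < q ^+ n.
Proof.
move=> q1; have [K0|K0] := leP K 0.
  by exists 0%N; rewrite expr0 (le_lt_trans K0).
have : (q^-1 ^+ n @[n --> \oo] --> 0).
  by apply: cvg_expr; rewrite ger0_norm ?invr_ge0 ?invf_lt1 //; lra.
move=> /cvgrPdist_lt/(_ K^-1); rewrite invr_gt0 K0 => /(_ isT)[n _ /(_ n)].
rewrite /= sub0r normrN exprVn leqnn => /(_ isT).
rewrite gtr0_norm ?invr_gt0 ?exprn_gt0 //; last by lra.
rewrite ltf_pV2 ?posrE ?exprn_gt0 //; last by lra.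
by exists n.
Qed.

(** The number whose digits are 101010... in base [q]. *)
Definition alternating_value (R : realType) (q : R) : R := q / (q ^+ 2 - 1).

Section Univoque.
Variables (R : realType) (q : R).
Hypotheses (q_gt1 : 1 < q) (q_lt2 : q < 2).
Local Notation E := (expansions q).
Local Notation M := ((q - 1)^-1).
Local Notation c := (alternating_value q).

Let q_gt0 : 0 < q. Proof. by move: q_gt1; lra. Qed.
Let q_neq0 : q != 0. Proof. by rewrite gt_eqF. Qed.
Let q1_gt0 : 0 < q - 1. Proof. by move: q_gt1; lra. Qed.
Let q1_neq0 : q - 1 != 0. Proof. by rewrite gt_eqF. Qed.
Let q21_gt0 : 0 < q ^+ 2 - 1. Proof. by move: q_gt1; nra. Qed.
Let q21_neq0 : q ^+ 2 - 1 != 0. Proof. by rewrite gt_eqF. Qed.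
Let M_gt0 : 0 < M. Proof. by rewrite invr_gt0. Qed.
Let M_gt1 : 1 < M. Proof. by rewrite invf_gt1 //; move: q_lt2; lra. Qed.
Let Mq : M * (q - 1) = 1. Proof. by rewrite mulVf. Qed.
Let cq : c * (q ^+ 2 - 1) = q. Proof. by rewrite mulfVK. Qed.
Let c_gt0 : 0 < c. Proof. by rewrite divr_gt0. Qed.

Lemma alternating_lt1 : q + 1 < q ^+ 2 -> c < 1.
Proof. by move=> qG; rewrite ltr_pdivrMr // mul1r; lra. Qed.

Lemma alternating_gt1 : c < 1 -> q + 1 < q ^+ 2.
Proof. by rewrite ltr_pdivrMr // mul1r; lra. Qed.

(** The hypothesis says that [q] exceeds the golden ratio, equivalently that
    [c < 1]; then the orbit of [c], which alternates between [c] and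
    [q * c - 1 = c / q], misses the switch region. *)
Lemma expansions_alternating : q + 1 < q ^+ 2 -> E c #= `I_1.
Proof.
move=> qG.
have c1 := alternating_lt1 qG.
have ch : M < q * c.
  rewrite -subr_gt0 (_ : _ - _ = (q ^+ 2 - q - 1) / (q ^+ 2 - 1)); last first.
    by rewrite /alternating_value; field; rewrite q21_neq0.
  by rewrite divr_gt0 //; lra.
have cc : q * (q * c - 1) = c.
  by rewrite /alternating_value; field.
have digit n : (forall e, E c e -> e n = ~~ odd n) /\
               (forall e, E (q * c - 1) e -> e n = odd n).
  elim: n => [|n [IH1 IH2]]; split=> e.
  - by rewrite expansions_high // => -[f _ <-].
  - by rewrite expansions_low ?cc // => -[f _ <-].
  - by rewrite expansions_high // => -[f cf <-] /=; rewrite (IH2 _ cf) negbK.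
  - by rewrite expansions_low ?cc // => -[f cf <-] /=; rewrite (IH1 _ cf).
have [e ce] : E c !=set0.
  by apply: expansions_nonempty => //; rewrite ltW //=; move: Mq; nra.
rewrite (_ : E c = [set e]) ?card_set1 //.
apply/seteqP; split=> [f cf|_ -> //]; apply/funext => n.
by rewrite ((digit n).1 _ cf) ((digit n).1 _ ce).
Qed.

Lemma expansions_alternating_shift n :
  q + 1 < q ^+ 2 -> E (c / q ^+ n) #= `I_1.
Proof.
move=> qG; elim: n => [|n IH];
  first by rewrite expr0 divr1 expansions_alternating.
have qE : q * (c / q ^+ n.+1) = c / q ^+ n.
  by rewrite exprS; field; rewrite q_neq0 expf_neq0.
rewrite (card_eq_trans _ IH) // -qE card_expansions_low // qE.
rewrite ltr_pdivrMr ?exprn_gt0 // mul1r (lt_le_trans (alternating_lt1 qG)) //.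
by rewrite exprn_ege1 // ltW.
Qed.

Hypothesis q_le : q ^+ 3 - 2 * q ^+ 2 + q - 1 <= 0.

(** In a unique expansion the remainder after a digit 0 is less than 1, and
    the remainder after a digit 1 exceeds [M - 1].  When [q * (q - 1) ^ 2 <= 1]
    these bounds exclude the blocks 011 and 100, so a 1 that comes after a 0 is
    followed by 01. *)
Let alternating_step y : E y #= `I_1 -> y < 1 -> M < q * y ->
  let z := q * (q * y - 1) in [/\ E z #= `I_1, z < 1 & M < q * z].
Proof.
move=> yU y1 My z.
have [[? _]|[_ y1U]] := unique_step q_gt1 q_lt2 yU; first by exfalso;
  move: M_gt1; lra.
have [[z1 zU]|[zM _]] := unique_step q_gt1 q_lt2 y1U; last first.
  exfalso.
  have : q * (q * y - 1) < q * (q - 1) by rewrite ltr_pM2l // ltrD2r gtr_pMr.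
  have : q * (q - 1) <= M by rewrite -(ler_pM2r q1_gt0) Mq; move: q_le; lra.
  by move: zM; lra.
split=> //.
have [[z2 _]|[]//] := unique_step q_gt1 q_lt2 zU.
exfalso; move: z2; apply/negP; rewrite -leNgt /z.
have : q * (q * (M - 1)) <= q * (q * (q * y - 1)).
  by rewrite !ler_pM2l //; lra.
apply: le_trans; rewrite -(ler_pM2r q1_gt0) mul1r.
rewrite (_ : _ * (q - 1) = q * q * (M * (q - 1) - (q - 1))); last by ring.
by rewrite Mq; move: q_le; lra.
Qed.

(** The map [f], which reads the digits 10, expands distances to its fixed
    point [c] by [q ^ 2], while the orbit stays bounded. *)
Lemma unique_leading_one y : E y #= `I_1 -> y < 1 -> M < q * y ->
  q + 1 < q ^+ 2 /\ y = c.
Proof.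
move=> yU y1 My.
pose f y : R := q * (q * y - 1).
have P n : [/\ E (iter n f y) #= `I_1, iter n f y < 1 & M < q * iter n f y].
  by elim: n => [//|n [U l h]]; rewrite iterS; exact: alternating_step.
have D n : iter n f y - c = (q ^+ 2) ^+ n * (y - c).
  elim: n => [|n IH]; first by rewrite expr0 mul1r.
  rewrite iterS exprS -mulrA -IH /f /alternating_value; field.
  exact: q21_neq0.
suff yc : y = c by split=> //; apply: alternating_gt1; rewrite -yc.
apply/eqP; rewrite -subr_eq0; apply/negP => /negP yc.
have [n] := @expr_unbounded _ (q ^+ 2) ((1 + c) / `|y - c|) ltac:(move: q_gt1;
  nra).
rewrite ltr_pdivrMr ?normr_gt0 //.
have -> : (q ^+ 2) ^+ n * `|y - c| = `|iter n f y - c|.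
  by rewrite D normrM [in RHS]ger0_norm // !exprn_ge0 // ltW.
have [iU i1 _] := P n.
have /andP[i0 _] := card_expansions_range q_gt1 iU isT.
by move: c_gt0; case: (ler0P (iter n f y - c)); lra.
Qed.

(** Leading zeros can be removed until a 1 shows up, because the remainders
    grow geometrically unless they vanish. *)
Lemma unique_lt1 y : E y #= `I_1 -> y < 1 ->
  y = 0 \/ q + 1 < q ^+ 2 /\ exists n, y = c / q ^+ n.
Proof.
move=> yU y1.
have /andP[] := card_expansions_range q_gt1 yU isT.
rewrite le_eqVlt => /predU1P[->|y0 _]; [by left|right].
have [N] := expr_unbounded (1 / y) q_gt1; rewrite ltr_pdivrMr //.
elim: N y yU y1 y0 => [|N IH] y yU y1 y0 Ny; first by exfalso; move: Ny;
  rewrite expr0; lra.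
have [[qy qyU]|[qy _]] := unique_step q_gt1 q_lt2 yU; last first.
  have [qG ->] := unique_leading_one yU y1 qy.
  by split=> //; exists 0%N; rewrite expr0 divr1.
have [||qG [n qyn]] := IH _ qyU qy.
- by rewrite mulr_gt0.
- by rewrite mulrA -exprSr.
- split=> //; exists n.+1; apply: (mulfI q_neq0); rewrite qyn exprS.
  by field; rewrite q_neq0 expf_neq0.
Qed.

Lemma unique_ge1 y : E y #= `I_1 -> 1 <= y ->
  y = M \/ q + 1 < q ^+ 2 /\ exists n, y = M - c / q ^+ n.
Proof.
move=> yU y1.
have [[qy _]|[qy _]] := unique_step q_gt1 q_lt2 yU; first by exfalso;
  move: q_gt1; nra.
have MyU : E (M - y) #= `I_1 by apply: card_eq_trans yU;
  exact: card_expansions_reflect.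
have My1 : M - y < 1.
  rewrite -(ltr_pM2l q_gt0).
  by move: q_gt1 qy (fixed_right_end q_gt1); lra.
have [My|[qG [n My]]] := unique_lt1 MyU My1; first by left; lra.
by right; split=> //; exists n; lra.
Qed.

End Univoque.

(** * Two and three expansions below the threshold *)

(** The values [s] for which [c * s] may be a univoque number less than 1. *)
Definition zero_or_power (R : realType) (q s : R) : Prop :=
  s = 0 \/ exists n : nat, s = q ^- n.

Lemma zero_or_power_gap (R : realType) (q s : R) (k : nat) :
  1 < q -> zero_or_power q s -> 1 <= q ^+ k * s \/ q ^+ k.+1 * s <= 1.
Proof.
move=> q1 [->|[n ->]]; first by right; rewrite mulr0 ler01.
have q0 n' : 0 < q ^+ n' by rewrite exprn_gt0 // (lt_trans ltr01).
have [nk|kn] := leqP n k; [left|right].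
- by rewrite ler_pdivlMr // mul1r ler_eXn2l.
- by rewrite ler_pdivrMr // mul1r ler_eXn2l.
Qed.

Lemma zero_or_power_itv (R : realType) (q s : R) :
  1 < q -> zero_or_power q s -> 0 <= s <= 1.
Proof.
move=> q1 [->|[n ->]]; first by rewrite lexx ler01.
have q0 : 0 < q by rewrite (lt_trans ltr01).
by rewrite invr_ge0 (exprn_ge0 _ (ltW q0)) invf_le1 ?exprn_gt0 // exprn_ege1 //
  ltW.
Qed.

Section BelowThreshold.
Variables (R : realType) (q : R).
Hypotheses (q_gt1 : 1 < q) (q_lt2 : q < 2).
Hypothesis q_lt : q ^+ 3 - 2 * q ^+ 2 + q - 1 < 0.
Local Notation E := (expansions q).
Local Notation M := ((q - 1)^-1).
Local Notation c := (alternating_value q).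

Let q_gt0 : 0 < q. Proof. by move: q_gt1; lra. Qed.
Let q_neq0 : q != 0. Proof. by rewrite gt_eqF. Qed.
Let q1_neq0 : q - 1 != 0. Proof. by rewrite subr_eq0 gt_eqF. Qed.
Let q21_neq0 : q ^+ 2 - 1 != 0. Proof. by rewrite gt_eqF //; move: q_gt1;
  nra. Qed.
Let q_small : q < 44 / 25.
Proof.
rewrite ltNge; apply/negP => qh; move: q_lt; apply/negP; rewrite -leNgt.
have -> : q ^+ 3 - 2 * q ^+ 2 + q - 1 = q * (q - 1) ^+ 2 - 1 by ring.
have q1 : 19 / 25 <= q - 1 by lra.
have q2 : 57 / 100 <= (q - 1) ^+ 2 by nra.
by nra.
Qed.

(** The equation expresses that [c * s] and [M - c * t] are at distance 1.
    The size of [s], then that of [t], is squeezed between consecutive powers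
    of [q]: [s = q ^- 2] is the only possibility, [t <= q ^- 5] would give
    [q * (q - 1) ^ 2 >= 1], and [t >= q ^- 3] would make [q] at most the golden
    ratio. *)
Lemma two_powers s t : zero_or_power q s -> zero_or_power q t ->
  q + 1 < q ^+ 2 -> t <= s -> q * (s + t) = 2 + q - q ^+ 2 ->
  [/\ q ^+ 4 = 2 * q ^+ 2 + q + 1, q ^+ 2 * s = 1 & q ^+ 4 * t = 1].
Proof.
move=> ps pt qG ts st; move: q_gt1 q_small => q1 q2.
have /andP[s0 s1] := zero_or_power_itv q1 ps.
have /andP[t0 t1] := zero_or_power_itv q1 pt.
have s2 : q ^+ 2 * s = 1.
  have [|s2] := zero_or_power_gap 1 q1 ps; first by rewrite expr1; nra.
  have [s2'|s3] := zero_or_power_gap 2 q1 ps; first by apply/eqP;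
    rewrite eq_le s2 s2'.
  exfalso.
  have : q ^+ 2 * (q * (s + t)) <= 2 by nra.
  rewrite st.
  have : 0 < (q - 1) * (2 * q + 2 - q ^+ 3) by rewrite mulr_gt0 //; nra.
  by nra.
have t2 : q ^+ 2 * t = 2 * q + q ^+ 2 - q ^+ 3 - 1.
  have -> : q ^+ 2 * t = q * (q * (s + t)) - q ^+ 2 * s by ring.
  by rewrite st s2; ring.
have [t4|t5] := zero_or_power_gap 4 q1 pt; last first.
  exfalso; move: t5.
  have -> : q ^+ 5 * t = q ^+ 3 * (q ^+ 2 * t) by ring.
  rewrite t2; apply/negP; rewrite -ltNge -subr_gt0.
  have -> : q ^+ 3 * (2 * q + q ^+ 2 - q ^+ 3 - 1) - 1 =
    - (q ^+ 3 - 2 * q ^+ 2 + q - 1) * ((q - 1) * (q + 1) ^+ 2) by ring.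
  by rewrite mulr_gt0 ?oppr_gt0 // mulr_gt0 ?exprn_gt0 //; lra.
have [t3|t4'] := zero_or_power_gap 3 q1 pt.
  exfalso; move: t3.
  have -> : q ^+ 3 * t = q * (q ^+ 2 * t) by ring.
  rewrite t2; apply/negP; rewrite -ltNge -subr_gt0.
  have -> : 1 - q * (2 * q + q ^+ 2 - q ^+ 3 - 1) =
    (q ^+ 2 - (q + 1)) * ((q - 1) * (q + 1)) by ring.
  by rewrite !mulr_gt0 //; lra.
have t1' : q ^+ 4 * t = 1 by apply/eqP; rewrite eq_le t4 t4'.
split=> //.
have : (q - 1) * (q ^+ 4 - (2 * q ^+ 2 + q + 1)) = 0.
  have -> : (q - 1) * (q ^+ 4 - (2 * q ^+ 2 + q + 1)) =
     1 - q ^+ 2 * (2 * q + q ^+ 2 - q ^+ 3 - 1) by ring.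
  by rewrite -t2 mulrA -exprD t1' subrr.
by move/eqP; rewrite mulf_eq0 (negPf q1_neq0) subr_eq0 => /eqP.
Qed.

Let q_le : q ^+ 3 - 2 * q ^+ 2 + q - 1 <= 0. Proof. exact: ltW. Qed.

(** By the classification of univoque numbers, [y] is [c * s] and [y + 1] is
    [M - c * t], which leads to the equation of [two_powers]. *)
Lemma unique_pair y : E y #= `I_1 -> E (y + 1) #= `I_1 ->
  [/\ q + 1 < q ^+ 2, q ^+ 4 = 2 * q ^+ 2 + q + 1 & q ^+ 2 * y = c \/ q ^+ 4 *
    y = c].
Proof.
move=> yU y1U.
have Mq : M * (q - 1) = 1 by rewrite mulVf.
have cq : c * (q ^+ 2 - 1) = q by rewrite mulfVK.
have /andP[y0 _] := card_expansions_range q_gt1 yU isT.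
have /andP[_ yM] := card_expansions_range q_gt1 y1U isT.
have c0 : 0 < c by rewrite divr_gt0 //; move: q_gt1; nra.
have ct1 t : q + 1 < q ^+ 2 -> zero_or_power q t -> c * t < 1.
  move=> qG /(zero_or_power_itv q_gt1)/andP[t0 t1].
  have c1 := alternating_lt1 q_gt1 qG.
  by apply: le_lt_trans c1; rewrite ler_piMr // ltW.
have [ylt|yge] := ltP y 1; last first.
  exfalso; have [yE|[qG [n yE]]] := unique_ge1 q_gt1 q_lt2 q_le yU yge;
    first by lra.
  have := ct1 (q ^- n) qG ltac:(by right; exists n).
  by lra.
have y1ge : 1 <= y + 1 by lra.
suff [qG [s [t [ps pt ys yt]]]] : q + 1 < q ^+ 2 /\ exists s t : R,
    [/\ zero_or_power q s, zero_or_power q t, y = c * s & y + 1 = M - c * t].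
  have st : q * (s + t) = 2 + q - q ^+ 2.
    have : c * (s + t) = M - 1 by lra.
    move/(congr1 (fun z => z * (q ^+ 2 - 1))).
    have -> : c * (s + t) * (q ^+ 2 - 1) = c * (q ^+ 2 - 1) * (s + t) by ring.
    have -> : (M - 1) * (q ^+ 2 - 1) = M * (q - 1) * (q + 1) - (q ^+ 2 - 1) by
      ring.
    by rewrite cq Mq => ->; ring.
  have [ts|/ltW ts] := leP t s.
  - have [q4 s2 t4] := two_powers ps pt qG ts st; split=> //; left.
    by rewrite ys mulrCA s2 mulr1.
  - rewrite addrC in st.
    have [q4 s2 t4] := two_powers pt ps qG ts st; split=> //; right.
    by rewrite ys mulrCA t4 mulr1.
have z0 : zero_or_power q 0 by left.
have zn n : zero_or_power q (q ^- n) by right; exists n.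
have [yE|[qG [n yE]]] := unique_lt1 q_gt1 q_lt2 q_le yU ylt;
  have [y1E|[qG' [m y1E]]] := unique_ge1 q_gt1 q_lt2 q_le y1U y1ge.
- exfalso; move: y1E; rewrite yE add0r => M1; move: Mq q_lt2; rewrite -M1; lra.
- by split=> //; exists 0, (q ^- m); split=> //; rewrite mulr0.
- by split=> //; exists (q ^- n), 0; split=> //; rewrite mulr0 subr0.
- by split=> //; exists (q ^- n), (q ^- m).
Qed.

End BelowThreshold.

Section QuarticBase.
Variables (R : realType) (q : R).
Hypotheses (q_gt1 : 1 < q) (q_lt2 : q < 2).
Hypothesis q4 : q ^+ 4 = 2 * q ^+ 2 + q + 1.
Local Notation E := (expansions q).
Local Notation M := ((q - 1)^-1).
Local Notation c := (alternating_value q).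

Lemma quartic_golden : q + 1 < q ^+ 2.
Proof.
have qq : 0 < q ^+ 2 + q by rewrite addr_gt0 ?exprn_gt0 //; move: q_gt1; lra.
rewrite -subr_gt0 -(pmulr_lgt0 _ qq).
have -> : (q ^+ 2 - (q + 1)) * (q ^+ 2 + q) = q ^+ 4 - 2 * q ^+ 2 - q by ring.
by rewrite q4; lra.
Qed.

Lemma quartic_bounds : 17 / 10 < q < 7 / 4.
Proof.
have mono (a : R) : q ^+ 4 - (2 * q ^+ 2 + q + 1) - (a ^+ 4 - (2 * a ^+ 2 + a +
  1)) =
   (q - a) * ((q + a) * (q ^+ 2 + a ^+ 2 - 2) - 1) by ring.
rewrite q4 subrr in mono.
have pos (a : R) : 3 / 2 < a -> 0 < (q + a) * (q ^+ 2 + a ^+ 2 - 2) - 1.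
  move=> a1; have qq := quartic_golden; have q1 := q_gt1.
  have a2 : 9 / 4 < a ^+ 2 by nra.
  rewrite subr_gt0 -[X in X < _]mulr1; apply: ltr_pM; lra.
have below (a : R) : 3 / 2 < a -> a ^+ 4 - (2 * a ^+ 2 + a + 1) < 0 -> a < q.
  move=> /pos p fa; rewrite -subr_gt0 -(pmulr_lgt0 _ p) -mono; lra.
have above (a : R) : 3 / 2 < a -> 0 < a ^+ 4 - (2 * a ^+ 2 + a + 1) -> q < a.
  move=> /pos p fa; rewrite -subr_lt0 -(pmulr_llt0 _ p) -mono; lra.
by apply/andP; split; [apply: below|apply: above]; lra.
Qed.

Lemma quartic_below : q ^+ 3 - 2 * q ^+ 2 + q - 1 < 0.
Proof.
have /andP[q1 q2] := quartic_bounds.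
have -> : q ^+ 3 - 2 * q ^+ 2 + q - 1 = q * (q - 1) ^+ 2 - 1 by ring.
have q3 : (q - 1) ^+ 2 < 9 / 16 by nra.
by nra.
Qed.

Let q_le : q ^+ 3 - 2 * q ^+ 2 + q - 1 <= 0.
Proof. exact: ltW quartic_below. Qed.

(** Write [u = M - c * s].  For [s = q ^- 2] and [s = q ^- 4] the number
    [u - 1] is itself univoque.  A larger [s] makes [u - 1] negative.  For all
    other [s] the orbit of [u - 1] enters the switch region after one more
    zero, or two when [s = q ^- 3], at a point which by [unique_pair] should
    have remainder [c * q ^- 2] or [c * q ^- 4], and does not. *)
Lemma quartic_three_impossible u :
  E u #= `I_1 -> E (u - 1) #= `I_2 -> False.
Proof.
move=> uU v2.
have qG := quartic_golden.
have qT := quartic_below.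
have q3l : q + 2 < 2 * (q ^+ 3 - q ^+ 2).
  have -> : q ^+ 3 - q ^+ 2 = q ^+ 2 * (q - 1) by ring.
  have /andP[q1 q2] := quartic_bounds.
  have : (q + 1) * (7 / 10) < q ^+ 2 * (q - 1) by apply: ltr_pM; lra.
  have : (27 / 10) * (7 / 10) < (q + 1) * (7 / 10) by rewrite ltr_pM2r; lra.
  have : 17 / 10 * (17 / 10) < q ^+ 2 by rewrite expr2; apply: ltr_pM; lra.
  nra.
have q0 : 0 < q by rewrite (lt_trans ltr01).
have q2l : q ^+ 2 < 2 * q by rewrite expr2 ltr_pM2r.
have q1 := q_gt1.
have Mq : M * (q - 1) = 1 by rewrite mulVf // subr_eq0 gt_eqF.
have q21 : 0 < q ^+ 2 - 1 by lra.
have cq : c * (q ^+ 2 - 1) = q by rewrite mulfVK // gt_eqF.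
have c0 : 0 < c by rewrite divr_gt0.
have q40 : 0 < q ^+ 4 by rewrite exprn_gt0.
have q5 : q ^+ 5 = 2 * q ^+ 3 + q ^+ 2 + q.
  by rewrite exprS q4; ring.
(* All comparisons are made in the unit [c / q ^ 4], in which the numbers
   at stake are integral polynomials in [q]: here those of 1 and [M - 1]. *)
have one_c : q ^+ 4 = c * (q ^+ 3 + q ^+ 2 + q).
  have -> : c * (q ^+ 3 + q ^+ 2 + q) = c * (q ^+ 2 - 1) * q ^+ 3 - c * (q ^+ 5
    - (2 * q ^+ 3 + q ^+ 2 + q)) by ring.
  by rewrite cq q5 subrr mulr0 subr0 -exprS.
have Mc : q ^+ 4 * (M - 1) = c * (q ^+ 2 + 1).
  apply: (mulIf (_ : q ^+ 2 - 1 != 0)); first by rewrite gt_eqF.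
  have -> : c * (q ^+ 2 + 1) * (q ^+ 2 - 1) = c * (q ^+ 2 - 1) * (q ^+ 2 + 1)
    by ring.
  have -> : q ^+ 4 * (M - 1) * (q ^+ 2 - 1) =
    q ^+ 4 * (M * (q - 1) * (q + 1) - (q ^+ 2 - 1)) by ring.
  rewrite Mq cq; apply/eqP; rewrite -subr_eq0.
  have -> : q ^+ 4 * (1 * (q + 1) - (q ^+ 2 - 1)) - q * (q ^+ 2 + 1) =
    - q * (q - 1) * (q ^+ 4 - (2 * q ^+ 2 + q + 1)) by ring.
  by rewrite q4 subrr mulr0.
have v0 : 0 <= u - 1 by have /andP[] := card_expansions_range q_gt1 v2 isT.
have [s ps uE] : exists2 s, zero_or_power q s & u = M - c * s.
  have u1 : 1 <= u by lra.
  have [->|[_ [n ->]]] := unique_ge1 q_gt1 q_lt2 q_le uU u1.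
    by exists 0; [left|rewrite mulr0 subr0].
  by exists (q ^- n) => //; right; exists n.
have vE k : q ^+ 4 * (q ^+ k * (u - 1)) = c * (q ^+ k * (q ^+ 2 + 1 - q ^+ 4 *
  s)).
  have -> : q ^+ 4 * (q ^+ k * (u - 1)) =
      q ^+ k * (q ^+ 4 * (M - 1) - q ^+ 4 * c * s) by rewrite uE; ring.
  by rewrite Mc; ring.
have lt1 k : q ^+ k * (q ^+ 2 + 1 - q ^+ 4 * s) < q ^+ 3 + q ^+ 2 + q ->
    q ^+ k * (u - 1) < 1.
  by move=> h; rewrite -(ltr_pM2l q40) mulr1 vE {2}one_c ltr_pM2l.
have not1 : ~ (E (u - 1) #= `I_1).
  by move=> v1; have /card_eq_II := card_eq_trans (card_esym v2) v1.
(* [Y] is the value of [q * z] in that unit, and the conclusion is the one of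
   [unique_pair] for [y = q * z - 1]. *)
have sw z Y : E z #= `I_2 -> q ^+ 4 * (q * z) = c * Y ->
    q ^+ 3 + q ^+ 2 + q <= Y <= q ^+ 3 + 2 * q ^+ 2 + q + 1 ->
    Y = q ^+ 3 + 2 * q ^+ 2 + q \/ Y = q ^+ 3 + q ^+ 2 + q + 1.
  move=> z2 zY /andP[Y1 Y2].
  have zM : 1 <= q * z <= M.
    apply/andP; split; rewrite -(ler_pM2l q40) zY.
      by rewrite mulr1 one_c ler_pM2l.
    rewrite -[M](subrK 1) mulrDr mulr1 Mc {1}one_c -mulrDr ler_pM2l //; lra.
  have [za zb] := switch_two q_gt1 q_lt2 zM z2.
  have [|_ _ yc] := unique_pair q_gt1 q_lt2 qT zb; first by rewrite subrK.
  have yY : q ^+ 4 * (q * z - 1) = c * (Y - (q ^+ 3 + q ^+ 2 + q)).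
    by rewrite mulrBr mulr1 zY {1}one_c -mulrBr.
  have cI := mulfI (lt0r_neq0 c0).
  case: yc => yc; [left|right].
  - have : c * (Y - (q ^+ 3 + q ^+ 2 + q)) = c * q ^+ 2.
      by rewrite -yY -yc; ring.
    by move/cI; lra.
  - have : c * (Y - (q ^+ 3 + q ^+ 2 + q)) = c * 1 by rewrite -yY yc mulr1.
    by move/cI; lra.
have /andP[s0 _] := zero_or_power_itv q_gt1 ps.
have vlow : q * (u - 1) < 1.
  rewrite -[q in q * _]expr1; apply: lt1; rewrite expr1.
  have q4s : 0 <= q * (q ^+ 4 * s) by rewrite (mulr_ge0 (ltW q0)) // (mulr_ge0
    (ltW q40)).
  lra.
have qv2 : E (q * (u - 1)) #= `I_2.
  by apply: card_eq_trans v2; exact: card_esym (card_expansions_low q_gt1 vlow).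
have [s1|s2] := zero_or_power_gap 1 q_gt1 ps.
  have := vE 0%N; rewrite expr0 !mul1r => v0E.
  have : 0 <= q ^+ 2 + 1 - q ^+ 4 * s.
    by rewrite -(pmulr_rge0 _ c0) -v0E mulr_ge0 // ltW.
  have -> : q ^+ 4 * s = q ^+ 3 * (q ^+ 1 * s) by ring.
  have : q ^+ 3 * 1 <= q ^+ 3 * (q ^+ 1 * s) by rewrite ler_pM2l // exprn_gt0.
  by lra.
have [s2'|s3] := zero_or_power_gap 2 q_gt1 ps.
  have s2E : q ^+ 2 * s = 1 by apply/eqP; rewrite eq_le s2 s2'.
  apply: not1; rewrite (_ : u - 1 = c / q ^+ 4);
    first exact: expansions_alternating_shift.
  apply: (mulfI (lt0r_neq0 q40)); have := vE 0%N; rewrite expr0 !mul1r => ->.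
  have -> : q ^+ 4 * s = q ^+ 2 * (q ^+ 2 * s) by ring.
  by rewrite s2E mulr1 addrAC subrr add0r mulr1 mulrCA mulfV ?mulr1 //
    lt0r_neq0.
have [s3'|s4] := zero_or_power_gap 3 q_gt1 ps.
  have s4E : q ^+ 4 * s = q.
    have s3E : q ^+ 3 * s = 1 by apply/eqP; rewrite eq_le s3 s3'.
    by rewrite exprS -mulrA s3E mulr1.
  have v2low : q * (q * (u - 1)) < 1.
    rewrite mulrA -expr2; apply: lt1; rewrite s4E.
    have -> : q ^+ 2 * (q ^+ 2 + 1 - q) = q ^+ 4 + q ^+ 2 - q ^+ 3 by ring.
    rewrite q4; lra.
  have q2v2 : E (q * (q * (u - 1))) #= `I_2.
    by apply: card_eq_trans qv2;
      exact: card_esym (card_expansions_low q_gt1 v2low).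
  have [||YE|YE] := sw _ (3 * q ^+ 3 - q ^+ 2 - 1) q2v2; [| |lra|lra].
    have -> : q * (q * (q * (u - 1))) = q ^+ 3 * (u - 1) by ring.
    rewrite vE s4E; congr (_ * _).
    have -> : q ^+ 3 * (q ^+ 2 + 1 - q) = q ^+ 5 + q ^+ 3 - q ^+ 4 by ring.
    by rewrite q4 q5; ring.
  by apply/andP; split; lra.
have [s4'|s5] := zero_or_power_gap 4 q_gt1 ps.
  have s4E : q ^+ 4 * s = 1 by apply/eqP; rewrite eq_le s4 s4'.
  apply: not1; rewrite (_ : u - 1 = c / q ^+ 2);
    first exact: expansions_alternating_shift.
  apply: (mulfI (lt0r_neq0 q40)); have := vE 0%N; rewrite expr0 !mul1r => ->.
  by rewrite s4E addrK; field; rewrite lt0r_neq0.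
have sg0 : 0 <= q ^+ 6 * s by exact: mulr_ge0 (exprn_ge0 6 (ltW q0)) s0.
have sgq : q ^+ 6 * s <= q by rewrite exprS -mulrA ler_piMr // ltW.
have [||YE|YE] := sw _ (3 * q ^+ 2 + q + 1 - q ^+ 6 * s) qv2.
- have -> : q * (q * (u - 1)) = q ^+ 2 * (u - 1) by ring.
  rewrite vE; congr (_ * _).
  have -> : q ^+ 2 * (q ^+ 2 + 1 - q ^+ 4 * s) = q ^+ 4 + q ^+ 2 - q ^+ 6 * s
    by ring.
  by rewrite q4; ring.
- by apply/andP; split; lra.
- by lra.
- have [s6|s7] := zero_or_power_gap 6 q_gt1 ps.
    have : 0 < (q - 1) * (q ^+ 2 - (q + 1)) by rewrite mulr_gt0 // subr_gt0.
    by lra.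
  move: s7; rewrite exprS -mulrA.
  have -> : q ^+ 6 * s = 2 * q ^+ 2 - q ^+ 3 by lra.
  have -> : q * (2 * q ^+ 2 - q ^+ 3) = 2 * q ^+ 3 - q ^+ 4 by ring.
  by rewrite q4; lra.
Qed.

End QuarticBase.

(** Two expansions already force the quartic base, and in that base a number
    with three expansions would have remainders at distance 1 of which one is
    univoque and the other has two expansions; by reflection the univoque one
    may be taken to be the larger. *)
Lemma below_threshold (R : realType) (q : R) : 1 < q -> q < 2 ->
  q ^+ 3 - 2 * q ^+ 2 + q - 1 < 0 ->
  (exists x, expansions q x #= `I_2) -> ~ (exists x, expansions q x #= `I_3).
Proof.
move=> q1 q2 qT [x /(exists_switch q1)/(_ isT)[z zs zE]] [x' /(exists_switch
  q1)/(_ isT)[z' zs' zE']].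
have [za zb] := switch_two q1 q2 zs zE.
have [|_ q4 _] := unique_pair q1 q2 qT zb; first by rewrite subrK.
have no := quartic_three_impossible q1 q2 q4.
have [[za' zb']|[za' zb']] := switch_three q1 q2 zs' zE'.
- exact: no za' zb'.
- apply: (no ((q - 1)^-1 - (q * z' - 1))).
    by apply: card_eq_trans zb'; exact: card_expansions_reflect.
  rewrite (_ : _ - 1 = (q - 1)^-1 - q * z'); last by ring.
  by apply: card_eq_trans za'; exact: card_expansions_reflect.
Qed.

(** * All multiplicities at the threshold *)

Definition prefix0110 (e : nat -> bool) : nat -> bool :=
  cons_seq false (cons_seq true (cons_seq true (cons_seq false e))).

Lemma iter_prefix0110 n e f i :
  (i < n)%N -> iter n prefix0110 e i = iter n prefix0110 f i.
Proof.
elim: n i => [//|n IH] [|[|[|[|i]]]] //= ni; apply: IH.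
by rewrite ltnW // ltnW // ltnW.
Qed.

(** Unfolding the inclusion, an element of [A] either reaches [C] after
    removing finitely many blocks 0110, or it is the periodic sequence
    0110 0110 ... *)
Lemma countable_prefix0110 (A C : set (nat -> bool)) :
  countable C -> A `<=` C `|` prefix0110 @` A -> countable A.
Proof.
move=> cC AC.
pose B := \bigcup_n (iter n prefix0110 @` C).
(* The digit [i] lies in the first [i.+1] blocks, so the tail is immaterial. *)
pose e0 i := iter i.+1 prefix0110 (fun=> false) i.
apply: (@sub_countable _ _ _ (B `|` [set e0])); last first.
  rewrite -bigcup2E; apply: bigcup_countable => // -[|[|n]] _;
    rewrite /bigcup2 /=.
  - apply: bigcup_countable => // n _;
    exact: sub_countable (card_image_le _ _) cC.
  - exact: countable1.
  - exact: countable0.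
apply: subset_card_le => e Ae.
have [[n [d Cd de]]|nC] := pselect (exists n, (iter n prefix0110 @` C) e).
  by left; exists n => //; exists d.
right; apply/funext => i.
have /(_ i.+1)[d _ <-] : forall n, (iter n prefix0110 @` A) e.
  elim=> [|n [d Ad de]]; first by exists e.
  have [Cd|[d' Ad' dd']] := AC _ Ad; last by exists d' => //;
    rewrite iterSr dd'.
  by case: nC; exists n, d.
exact: iter_prefix0110.
Qed.

(** The concatenation of the blocks 10000 and 01101, chosen by [f]. *)
Definition block_seq (f : nat -> bool) (n : nat) : bool :=
  nth false (if f (n %/ 5)%N then [:: true; false; false; false; false]
             else [:: false; true; true; false; true]) (n %% 5)%N.

Lemma block_seq_inj : injective block_seq.
Proof.
move=> f g fg; apply/funext => i; have := congr1 (@^~ (i * 5)%N) fg.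
by rewrite /block_seq mulnK // modnMl; case: (f i); case: (g i).
Qed.

Lemma normr_nth_le (R : realType) (s : seq R) i :
  `|nth 0 s i| <= \sum_(y <- s) `|y|.
Proof.
elim: s i => [|y s IH] [|i] /=; rewrite ?big_nil ?normr0 // big_cons.
  by rewrite lerDl sumr_ge0.
by rewrite (le_trans (IH i)) // lerDr.
Qed.

Section Threshold.
Variables (R : realType) (q : R).
Hypotheses (q_gt1 : 1 < q) (q_lt2 : q < 2).
Hypothesis q3 : q ^+ 3 = 2 * q ^+ 2 - q + 1.
Local Notation E := (expansions q).
Local Notation M := ((q - 1)^-1).
Local Notation c := (alternating_value q).

Let q_gt0 : 0 < q. Proof. by move: q_gt1; lra. Qed.
Let q_neq0 : q != 0. Proof. by rewrite gt_eqF. Qed.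
Let q1_neq0 : q - 1 != 0. Proof. by rewrite subr_eq0 gt_eqF. Qed.

Let q4 : q ^+ 4 = q ^+ 3 + q ^+ 2 + 1.
Proof.
apply/eqP; rewrite -subr_eq0.
have -> : q ^+ 4 - (q ^+ 3 + q ^+ 2 + 1) =
  (q + 1) * (q ^+ 3 - (2 * q ^+ 2 - q + 1)) by ring.
by rewrite q3 subrr mulr0.
Qed.

Lemma threshold_golden : q + 1 < q ^+ 2.
Proof.
have qq : 0 < q ^+ 2 by rewrite exprn_gt0.
rewrite -subr_gt0 -(pmulr_lgt0 _ qq).
have -> : (q ^+ 2 - (q + 1)) * q ^+ 2 = q ^+ 4 - q ^+ 3 - q ^+ 2 by ring.
by rewrite q4; lra.
Qed.

Lemma threshold_right_end : M = q * (q - 1).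
Proof.
apply: (mulIf q1_neq0); rewrite mulVf //.
have -> : q * (q - 1) * (q - 1) = q ^+ 3 - 2 * q ^+ 2 + q by ring.
by rewrite q3; ring.
Qed.

Lemma threshold_inverse : q^-1 = q * (q * (q - 1) - 1).
Proof.
apply: (mulfI q_neq0); rewrite mulfV //.
have -> : q * (q * (q * (q - 1) - 1)) = q ^+ 4 - q ^+ 3 - q ^+ 2 by ring.
by rewrite q4; ring.
Qed.

(** The remainders of [q^-1] under the digits 0, 1, 1, 0 are 1, [q - 1],
    [M - 1] and again [q^-1].  Of these, [q^-1] and [q - 1] are the left and the
    right end point of the switch region, the others lie outside.  A positive
    perturbation pushes [q - 1] out as well, so that the digits 1, 1, 0 become
    forced once the first 0 is chosen. *)
Lemma card_expansions_loop d : 0 < d -> q^-1 + d < 1 ->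
  E (1 + d / q ^+ 3) #= E (q^-1 + d).
Proof.
move=> d0 d1.
have e0 : 0 < d / q ^+ 3 by rewrite divr_gt0 // exprn_gt0.
have dE : q * (q * (q * (d / q ^+ 3))) = d by field.
move: (d / q ^+ 3) e0 dE => e e0 dE.
have MM := threshold_right_end; have qG := threshold_golden.
have qe : 0 < q * e by rewrite mulr_gt0.
have qqe : 0 < q * (q * e) by rewrite mulr_gt0.
have h1 : M < q * (1 + e).
  have : q * (q - 1) < q * 1 by rewrite ltr_pM2l //; move: q_lt2; lra.
  by rewrite MM; lra.
have h2 : M < q * (q * (1 + e) - 1) by rewrite MM; lra.
have h3 : q * (q * (q * (1 + e) - 1) - 1) = q^-1 + d.
  by rewrite threshold_inverse -dE; ring.
apply: card_eq_trans (card_expansions_high q_gt1 h1) _.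
apply: card_eq_trans (card_expansions_high q_gt1 h2) _.
by rewrite -h3; apply: card_expansions_low => //; rewrite h3.
Qed.

(** With digits 0110 repeated [m] times before 101010..., the number is
    [x m].  The digit 1 leaves the loop at once towards the univoque
    number [c / q ^ (4 * m + 1)], and the digits 0110 lead to [x m.-1]: each
    turn adds one expansion. *)
Lemma threshold_finite k : (0 < k)%N -> exists2 x, Iq q x & E x #= `I_k.
Proof.
case: k => // n _.
have qG := threshold_golden; have c1 := alternating_lt1 q_gt1 qG.
have c0 : 0 < c by rewrite divr_gt0 // subr_gt0; move: q_gt1 qG; lra.
pose x m : R := q^-1 + c / q ^+ (4 * m + 2).
have cE : x 0%N = c.
  rewrite /x /alternating_value muln0 add0n; field; rewrite q_neq0 gt_eqF //.
  by rewrite subr_gt0; move: q_gt1 qG; lra.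
have x1 m : x m < 1.
  apply: le_lt_trans c1; rewrite -cE /x lerD2l ler_pM2l //.
  by rewrite lef_pV2 ?posrE ?exprn_gt0 // ler_eXn2l // muln0 leq_addl.
have xn : E (x n) #= `I_n.+1.
  elim: n => [|n IH]; first by rewrite cE; exact: expansions_alternating.
  have qx : q * x n.+1 = 1 + c / q ^+ (4 * n + 2) / q ^+ 3.
    rewrite /x; have -> : q ^+ (4 * n.+1 + 2) = q * (q ^+ (4 * n + 2) * q ^+ 3).
      by rewrite -exprD -exprS; congr (_ ^+ _);
        rewrite mulnSr -[in RHS]addnA -addnS -addnA.
    by field; rewrite q_neq0 expf_neq0.
  rewrite -[n.+2]addn1; apply: (card_expansions_add q_gt1).
    rewrite qx; apply: card_eq_trans IH; apply: card_expansions_loop;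
      last exact: x1.
    by rewrite divr_gt0 // exprn_gt0.
  rewrite qx addrAC subrr add0r -mulrA -invfM -exprD.
  exact: expansions_alternating_shift.
exists (x n) => //; rewrite /Iq /= in_itv /=.
exact: (card_expansions_range q_gt1 xn).
Qed.

(** For [q^-1] itself the loop 0110 has two exits, to 0 after the digit 1 and
    to [M] after the digits 010.  They contribute two expansions per turn, so
    the multiplicity [k] would satisfy [k = k + 2] if it were finite. *)
Lemma threshold_countable : exists2 x, Iq q x & E x #= [set: nat].
Proof.
have MM := threshold_right_end; have qG := threshold_golden.
have M1 : M < q * 1.
  by rewrite MM ltr_pM2l //; move: q_lt2; lra.
have qV : q * q^-1 = 1 by rewrite mulfV.
have low : q * (q * (q - 1) - 1) < 1.
  by rewrite -threshold_inverse invf_lt1.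
have E1 : E 1 = cons_seq true @` E (q - 1) by rewrite expansions_high // mulr1.
exists q^-1.
  rewrite /Iq /= in_itv /= invr_ge0 ltW //= (le_trans (ltW (_ : q^-1 < 1)))
    ?invf_lt1 //.
  by rewrite ltW // invf_gt1; move: q_lt2; lra.
apply: eq_card_nat.
- apply: (@countable_prefix0110 _ ([set cons_seq true (fun=> false);
     cons_seq false (cons_seq true (cons_seq false (fun=> true)))])).
    by apply: finite_set_countable.
  move=> e; rewrite {1}expansions_split // qV subrr expansions0 //.
  move=> [[f + <-]|[f -> <-]]; last by left; left.
  rewrite E1 => -[g + <-]; rewrite expansions_split // -MM.
  move=> [[h + <-]|[h + <-]]; first by rewrite expansionsM // => ->; left;
    right.
  rewrite MM expansions_low // -threshold_inverse => -[h' eh' <-].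
  by right; exists h'.
- move=> [k kE].
  have h4 : E (q * (q - 1) - 1) #= `I_k.
    apply: card_eq_trans kE; rewrite threshold_inverse.
    exact: card_expansions_low.
  have h3 : E (q - 1) #= `I_(1 + k).
    apply: (card_expansions_add q_gt1); last exact: h4.
    by rewrite -MM (expansionsM q_gt1); exact: card_set1.
  have h2 : E 1 #= `I_(1 + k).
    apply: card_eq_trans h3.
    have := card_expansions_high q_gt1 M1; rewrite mulr1; exact.
  have h1 : E q^-1 #= `I_(1 + k + 1).
    apply: (card_expansions_add q_gt1); rewrite qV; first exact: h2.
    by rewrite subrr (expansions0 q_gt1); exact: card_set1.
  have /card_eq_II/eqP : `I_k #= `I_(1 + k + 1).
    by apply: card_eq_trans h1; rewrite card_eq_sym.
  by rewrite addn1 add1n ltn_eqF // ltnW.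
Qed.

(** Because [q ^ 4 = q ^ 3 + q ^ 2 + 1], the blocks 10000 and 01101 have the same
    value and may be exchanged at each position independently. *)
Lemma block_seq_expansion f : E (q ^+ 4 / (q ^+ 5 - 1)) (block_seq f).
Proof.
have q51 : q ^+ 5 - 1 != 0.
  by rewrite gt_eqF // subr_gt0 exprn_egt1.
set x := _ / _.
have xE : x * (q ^+ 5 - 1) = q ^+ 4 by rewrite mulfVK.
(* The five remainders met while reading the block 10000, resp. 01101. *)
pose s1 := [:: x; q * x - 1; q ^+ 2 * x - q; q ^+ 3 * x - q ^+ 2;
  q ^+ 4 * x - q ^+ 3].
pose s0 := [:: x; q * x; q ^+ 2 * x - 1; q ^+ 3 * x - q - 1;
  q ^+ 4 * x - q ^+ 2 - q].
pose r n := nth 0 (if f (n %/ 5)%N then s1 else s0) (n %% 5)%N.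
have r0 i : r (i * 5)%N = x by rewrite /r mulnK // modnMl; case: ifP.
rewrite -(r0 0%N); apply: (@expansion_of_orbit _ _ q_gt1 _ _
  (\sum_(y <- s1) `|y| + \sum_(y <- s0) `|y|)) => n.
  rewrite /r; case: ifP => _; apply: (le_trans (normr_nth_le _ _)).
    by rewrite lerDl sumr_ge0.
  by rewrite lerDr sumr_ge0.
have rE j i : (j < 5)%N -> r (i * 5 + j)%N = nth 0 (if f i then s1 else s0) j.
  by move=> j5; rewrite /r divnMDl // modnMDl modn_small // divn_small // addn0.
have bE j i : (j < 5)%N -> block_seq f (i * 5 + j)%N = nth false
    (if f i then [:: true; false; false; false; false]
             else [:: false; true; true; false; true]) j.
  by move=> j5; rewrite /block_seq divnMDl // modnMDl modn_small // divn_small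
    // addn0.
rewrite (divn_eq n 5);
  move: (n %/ 5)%N (n %% 5)%N (ltn_pmod n (isT : 0 < 5)%N) => i j j5.
rewrite rE // bE //.
have [j4|j4] := ltnP j 4.
  rewrite -addnS rE //.
  by case: j j4 {j5} => [|[|[|[|j]]]] // _; case: (f i) => /=; ring.
have -> : j = 4%N by apply/eqP; rewrite eqn_leq j4 andbT -ltnS.
rewrite (_ : (i * 5 + 4).+1 = i.+1 * 5)%N ?r0;
  last by rewrite -addnS mulSn addnC.
have xx : x = q ^+ 5 * x - q ^+ 4 by rewrite -xE; ring.
case: (f i) => /=; rewrite {1}xx.
- by ring.
- by move: q4; lra.
Qed.

Lemma threshold_continuum : exists2 x, Iq q x & E x #= [set: nat -> bool].
Proof.
exists (q ^+ 4 / (q ^+ 5 - 1)).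
  have := expansions_range q_gt1 (block_seq_expansion (fun=> true)).
  by rewrite /Iq /= in_itv /=.
rewrite card_eq_le card_leT /=.
apply: (@card_le_trans _ _ _ (block_seq @` setT)); last first.
  by apply: subset_card_le => _ [f _ <-]; exact: block_seq_expansion.
have /card_eqPle[] // : block_seq @` setT #= [set: nat -> bool].
by apply: inj_card_eq => f g _ _ /block_seq_inj.
Qed.

End Threshold.

(** * The threshold as a root of the cubic *)

Section Root.
Variable R : realType.
Implicit Types x y : R.

Lemma threshold_cubicE x :
  (x ^+ 3 = 2 * x ^+ 2 - x + 1) <-> x ^+ 3 - 2 * x ^+ 2 + x - 1 = 0.
Proof. by split; lra. Qed.

Lemma threshold_cubic_gt1 x : 0 <= x ^+ 3 - 2 * x ^+ 2 + x - 1 -> 1 < x.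
Proof.
have -> : x ^+ 3 - 2 * x ^+ 2 + x - 1 = x * (x - 1) ^+ 2 - 1 by ring.
rewrite subr_ge0 => h; rewrite ltNge; apply/negP => x1.
have x0 : 0 < x.
  rewrite ltNge; apply/negP => x0.
  by have : x * (x - 1) ^+ 2 <= 0 by [rewrite mulr_le0_ge0 // sqr_ge0]; lra.
have : (x - 1) ^+ 2 < 1 by nra.
have : 0 <= (x - 1) ^+ 2 by rewrite sqr_ge0.
by nra.
Qed.

Lemma threshold_cubic_mono x y : 1 < x -> x < y ->
  x ^+ 3 - 2 * x ^+ 2 + x - 1 < y ^+ 3 - 2 * y ^+ 2 + y - 1.
Proof.
move=> x1 xy; rewrite -subr_gt0.
have -> : y ^+ 3 - 2 * y ^+ 2 + y - 1 - (x ^+ 3 - 2 * x ^+ 2 + x - 1) =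
  (y - x) * ((x - 1) ^+ 2 + (y - 1) ^+ 2 + (x * y - 1)) by ring.
rewrite mulr_gt0 ?subr_gt0 // ltr_wpDl ?addr_ge0 ?sqr_ge0 // subr_gt0.
by nra.
Qed.

Lemma threshold_root : exists2 x : R, x ^+ 3 - 2 * x ^+ 2 + x - 1 = 0 &
  `|x - (1 + 754 / 10 ^+ 3 + 88 / 10 ^+ 5)| <= 5 / 10 ^+ 6.
Proof.
set m : R := 1 + 754 / 10 ^+ 3 + 88 / 10 ^+ 5.
set d : R := 5 / 10 ^+ 6.
pose f x : R := x ^+ 3 - 2 * x ^+ 2 + x - 1.
have d0 : 0 < d by rewrite /d; lra.
have fl : f (m - d) < 0 by rewrite /f /m /d; lra.
have fr : 0 < f (m + d) by rewrite /f /m /d; lra.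
have [|||x] := @IVT R f (m - d) (m + d) 0.
- lra.
- apply: continuous_subspaceT => x; rewrite /f.
  apply: cvgB; last exact: cvg_cst.
  apply: cvgD; last exact: cvg_id.
  apply: cvgB; first exact: exprn_continuous.
  by apply: cvgM; [exact: cvg_cst|exact: exprn_continuous].
- by rewrite ge_min (ltW fl) /= le_max (ltW fr) orbT.
rewrite in_itv /= => /andP[x1 x2] fx; exists x => //.
by rewrite ler_norml; apply/andP; split; lra.
Qed.
End Root.

Theorem theorem1p3 (R : realType) :
  exists qf : R,
    [/\ forall x : R, x ^+ 3 = 2 * x ^+ 2 - x + 1 <-> x = qf,
        `|qf - (1 + 754 / 10 ^+ 3 + 88 / 10 ^+ 5)| <= 5 / 10 ^+ 6,
        1 < qf < 2,
        all_multiplicities qf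
      & forall q : R, 1 < q < 2 -> all_multiplicities q -> qf <= q].
Proof.
have [qf qf0 qfa] := threshold_root R.
have qf1 : 1 < qf by apply: threshold_cubic_gt1; rewrite qf0.
have qf2 : qf < 2.
  by rewrite ltNge; apply/negP => q2; move: qfa; rewrite ler_norml; lra.
have qf3 := (threshold_cubicE qf).2 qf0.
exists qf; split=> //.
- move=> x; split=> [/threshold_cubicE x0|-> //].
  have x1 : 1 < x by apply: threshold_cubic_gt1; rewrite x0.
  have [/threshold_cubic_mono|/threshold_cubic_mono|//] := ltgtP x qf.
  + by move=> /(_ x1); rewrite x0 qf0 ltxx.
  + by move=> /(_ qf1); rewrite x0 qf0 ltxx.
- by rewrite qf1.
- split; [exact: threshold_finite|exact: threshold_countable|exact:
  threshold_continuum].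
- move=> q /andP[q1 q2] [qk _ _]; rewrite leNgt; apply/negP => qqf.
  have [x _ x2] := qk 2%N isT; have [y _ y3] := qk 3%N isT.
  apply: (@below_threshold R q) => //; last 2 first.
  + by exists x.
  + by exists y.
  by rewrite -qf0; exact: threshold_cubic_mono.
Qed.
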